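(* Consider the $\mathrm{FS}_\varepsilon$ algorithm with learning rate $\varepsilon>0$. Let $k\ge0$ be the total number of iterations. Then there exists an index $i\in\{0,\ldots,k\}$ for which the following bounds all hold: (i) (training error) $L_n(\hat\beta^i)-L_n^*\le\frac{p}{2n\lambda_{\mathrm{pmin}}(\mathbf{X}^T\mathbf{X})}\left[\frac{\|\mathbf{X}\hat\beta_{LS}\|_2^2}{\varepsilon(k+1)}+\varepsilon\right]^2$; (ii) (regression coefficients) there exists a least squares solution $\hat\beta^i_{LS}$ such that $$\|\hat\beta^i-\hat\beta^i_{LS}\|_2\le\frac{\sqrt p}{\lambda_{\mathrm{pmin}}(\mathbf{X}^T\mathbf{X})}\left[\frac{\|\mathbf{X}\hat\beta_{LS}\|_2^2}{\varepsilon(k+1)}+\varepsilon\right];$$ (iii) (predictions) for every least squares solution $\hat\beta_{LS}$, $$\|\mathbf{X}\hat\beta^i-\mathbf{X}\hat\beta_{LS}\|_2\le\frac{\sqrt p}{\sqrt{\lambda_{\mathrm{pmin}}(\mathbf{X}^T\mathbf{X})}}\left[\frac{\|\mathbf{X}\hat\beta_{LS}\|_2^2}{\varepsilon(k+1)}+\varepsilon\right];$$ (iv) (correlation values) $\|\mathbf{X}^T\hat r^i\|_\infty\le\frac{\|\mathbf{X}\hat\beta_{LS}\|_2^2}{2\varepsilon(k+1)}+\frac{\varepsilon}{2}$; (v) ($\ell_1$-shrinkage of coefficients) $\|\hat\beta^i\|_1\le k\varepsilon$; (vi) (sparsity of coefficients) $\|\hat\beta^i\|_0\le k$.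
   Context: Standing data: $\mathbf{X}=[\mathbf{X}_1,\ldots,\mathbf{X}_p]\in\mathbb{R}^{n\times p}$ has columns with zero mean and unit $\ell_2$ norm, and $\mathbf{y}\in\mathbb{R}^n$ has zero mean. $L_n(\beta):=\frac{1}{2n}\|\mathbf{y}-\mathbf{X}\beta\|_2^2$, $L_n^*:=\min_{\beta\in\mathbb{R}^p}L_n(\beta)$. A least squares solution $\hat\beta_{LS}$ is any minimizer of $L_n$; $\mathbf{X}\hat\beta_{LS}$ does not depend on which minimizer is chosen. $\lambda_{\mathrm{pmin}}(Q)$ denotes the smallest nonzero (hence positive) eigenvalue of a nonzero symmetric positive semidefinite matrix $Q$. $\|v\|_0$ is the number of nonzero entries of $v$. $\mathrm{sgn}(a)\in\{-1,0,1\}$ is the sign of $a$, with $\mathrm{sgn}(0)=0$. Algorithm $\mathrm{FS}_\varepsilon$ (incremental forward stagewise regression): initialize $\hat r^0=\mathbf{y}$, $\hat\beta^0=0$. For $k=0,1,2,\ldots$: choose any $j_k\in\arg\max_{j\in\{1,\ldots,p\}}|(\hat r^k)^T\mathbf{X}_j|$, and set $\hat r^{k+1}=\hat r^k-\varepsilon\,\mathrm{sgn}((\hat r^k)^T\mathbf{X}_{j_k})\mathbf{X}_{j_k}$, $\hat\beta^{k+1}_{j_k}=\hat\beta^k_{j_k}+\varepsilon\,\mathrm{sgn}((\hat r^k)^T\mathbf{X}_{j_k})$, and $\hat\beta^{k+1}_j=\hat\beta^k_j$ for $j\neq j_k$. *)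

(* Defs.v *)
From HB Require Import structures.
From mathcomp Require Import all_boot all_order all_algebra.
From mathcomp Require Import all_classical all_reals all_analysis.

Set Implicit Arguments.
Unset Strict Implicit.
Unset Printing Implicit Defensive.

Import Order.TTheory GRing.Theory Num.Theory.
Import numFieldNormedType.Exports.

Local Open Scope classical_set_scope.
Local Open Scope ring_scope.

Section Vectors.
Context {R : realType} {m : nat}.
Implicit Types u v : 'cV[R]_m.

Definition mean v : R := (\sum_i v i 0) / m%:R.

Definition dot u v : R := (u^T *m v) 0 0.

Definition l0norm v : nat := #|[set i | v i 0 != 0]%SET|.

Definition l1norm v : R := \sum_i `|v i 0|.

Definition l2norm v : R := Num.sqrt (\sum_i v i 0 ^+ 2).

(* the norm of the normed module of matrices is the largest absolute value of
   an entry, see mx_normrE *)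
Definition linfnorm v : R := `|v|.

End Vectors.

(* least element of A; junk value 0 if A has none *)
Definition minimum {R : realType} (A : set R) : R := xget 0 (A `&` lbound A).

Lemma minimumE {R : realType} (A : set R) (a : R) :
  A a -> lbound A a -> minimum A = a.
Proof.
move=> Aa la; apply: xget_unique; first by split.
by move=> b [Ab lb]; apply/le_anti; rewrite lb// la.
Qed.

(* [eigenvalue] refers to row eigenvectors, which makes no difference for the
   symmetric matrices this is meant for *)
Definition lambda_pmin {R : realType} {m : nat} (Q : 'M[R]_m) : R :=
  minimum [set l | eigenvalue Q l /\ l != 0].

Section LeastSquares.
Context {R : realType} {n p : nat}.
Variables (X : 'M[R]_(n, p)) (y : 'cV[R]_n).

Definition Ln (b : 'cV[R]_p) : R :=
  (2 * n%:R)^-1 * l2norm (y - X *m b) ^+ 2.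

Definition Lnstar : R := minimum (range Ln).

Definition is_LS (b : 'cV[R]_p) : Prop := forall b', Ln b <= Ln b'.

End LeastSquares.

Section ForwardStagewise.
Context {R : realType} {n p : nat}.
Variables (X : 'M[R]_(n, p)) (y : 'cV[R]_n) (eps : R).

Definition FS_step (r : 'cV[R]_n) (b : 'cV[R]_p)
    (r' : 'cV[R]_n) (b' : 'cV[R]_p) : Prop :=
  exists j : 'I_p,
    [/\ forall l, `|dot r (col l X)| <= `|dot r (col j X)|,
        r' = r - (eps * Num.sg (dot r (col j X))) *: col j X,
        b' j 0 = b j 0 + eps * Num.sg (dot r (col j X)) &
        forall l, l != j -> b' l 0 = b l 0].

(* [r] and [b] are the residuals and coefficients of some run of k iterations;
   their values beyond index k are unconstrained *)
Definition FS_run (k : nat) (r : nat -> 'cV[R]_n) (b : nat -> 'cV[R]_p) : Prop :=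
  [/\ r 0%N = y, b 0%N = 0 &
      forall t, (t < k)%N -> FS_step (r t) (b t) (r t.+1) (b t.+1)].

End ForwardStagewise.

(* Main.v *)
Require Import Defs.
From HB Require Import structures.
From mathcomp Require Import all_boot all_order all_algebra.
From mathcomp Require Import all_classical all_reals all_analysis.
From mathcomp Require Import ring lra.

Import Order.TTheory GRing.Theory Num.Theory.
Import numFieldNormedType.Exports.

Local Open Scope ring_scope.

(** Let [b0] solve the normal equations and put [s := y - X *m b0], so that
    [X^T *m s = 0].  Along a run, [d := r t - s = X *m (b0 - b t)] has the same
    correlations with the columns of [X] as the residual [r t].  As the columns
    are unit vectors and the step moves along one of maximal correlation,
    [dot d d] decreases by at least [2 * eps * linfnorm (X^T *m r t) - eps ^+ 2]
    ([FS_step_descent]).  It starts at [dot (X *m b0) (X *m b0)] and stays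
    nonnegative, so [k + 1] such decreases force one of the iterates
    [i <= k] to satisfy the bound on the correlations
    ([FS_run_small_correlation]).  This [i] serves for all the claims.

    The other error bounds follow from the correlation bound, because
    [X^T *m r i = X^T *m X *m (b0 - b i)] is, up to sign, the gradient at [b i]
    of a quadratic function whose curvature along the row space of [X] is at least
    [mu := lambda_pmin (X^T *m X)].  Indeed [mu] is the minimum of the Rayleigh
    quotient over the unit vectors of the row space
    ([lambda_pmin_rayleigh]): the minimum is attained by compactness, the
    first-order condition makes the minimizer an eigenvector, and eigenvectors
    of nonzero eigenvalues lie in the row space.  It follows that
    [mu * dot (X v) (X v) <= dot (X^T X v) (X^T X v)] for every [v]
    ([lambda_pmin_le_gram]), which turns a bound on the correlations into one on
    the predictions; Pythagoras' theorem ([Ln_normal]) turns that into one on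
    the training error, and the Rayleigh bound itself, applied to the component
    of [b i - b0] in the row space, into one on the coefficients
    ([exists_close_same_fit]).

    The bounds on the size and the support of [b i] hold since a step changes
    one coefficient, by at most [eps]. *)

(** * Inner products and norms *)

Lemma dotE (R : realType) (m : nat) (u v : 'cV[R]_m) :
  dot u v = \sum_i u i 0 * v i 0.
Proof. by rewrite /dot mxE; apply: eq_bigr => i _; rewrite mxE. Qed.

Lemma dotC (R : realType) (m : nat) (u v : 'cV[R]_m) : dot u v = dot v u.
Proof. by rewrite !dotE; apply: eq_bigr => i _; rewrite mulrC. Qed.

Lemma dot0v (R : realType) (m : nat) (v : 'cV[R]_m) : dot 0 v = 0.
Proof. by rewrite /dot trmx0 mul0mx mxE. Qed.

Lemma dotv0 (R : realType) (m : nat) (v : 'cV[R]_m) : dot v 0 = 0.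
Proof. by rewrite dotC dot0v. Qed.

Lemma dotvB (R : realType) (m : nat) (u v w : 'cV[R]_m) :
  dot u (v - w) = dot u v - dot u w.
Proof. by rewrite /dot mulmxBr !mxE. Qed.

Lemma dotvZ (R : realType) (m : nat) (a : R) (u v : 'cV[R]_m) :
  dot u (a *: v) = a * dot u v.
Proof. by rewrite /dot -scalemxAr mxE. Qed.

Lemma dotZZ (R : realType) (m : nat) (a : R) (v : 'cV[R]_m) :
  dot (a *: v) (a *: v) = a ^+ 2 * dot v v.
Proof. by rewrite dotvZ dotC dotvZ mulrA -expr2. Qed.

Lemma dot_mulmxl (R : realType) (m q : nat) (A : 'M[R]_(m, q))
    (u : 'cV[R]_q) (v : 'cV[R]_m) :
  dot (A *m u) v = dot u (A^T *m v).
Proof. by rewrite /dot trmx_mul mulmxA. Qed.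

Lemma dot_ge0 (R : realType) (m : nat) (v : 'cV[R]_m) : 0 <= dot v v.
Proof. by rewrite dotE sumr_ge0 // => i _; rewrite -expr2 sqr_ge0. Qed.

Lemma dot_eq0 (R : realType) (m : nat) (v : 'cV[R]_m) :
  dot v v = 0 -> v = 0.
Proof.
rewrite dotE => /eqP.
rewrite psumr_eq0 => [|i _]; last by rewrite -expr2 sqr_ge0.
move=> /allP v0; apply/colP => i; rewrite mxE.
by have := v0 i (mem_index_enum i); rewrite /= mulf_eq0 orbb => /eqP.
Qed.

Lemma dotDZ (R : realType) (m : nat) (a : R) (u v : 'cV[R]_m) :
  dot (u + a *: v) (u + a *: v) = dot u u + 2 * a * dot u v + a ^+ 2 * dot v v.
Proof.
rewrite !dotE 2!mulr_sumr -!big_split /=.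
by apply: eq_bigr => i _; rewrite !mxE; ring.
Qed.

Lemma l2norm_ge0 (R : realType) (m : nat) (v : 'cV[R]_m) : 0 <= l2norm v.
Proof. exact: sqrtr_ge0. Qed.

Lemma l2norm_sqr (R : realType) (m : nat) (v : 'cV[R]_m) :
  l2norm v ^+ 2 = dot v v.
Proof.
rewrite /l2norm sqr_sqrtr ?dotE.
  by apply: eq_bigr => i _; rewrite expr2.
by apply: sumr_ge0 => i _; rewrite sqr_ge0.
Qed.

Lemma le_linfnorm (R : realType) (q : nat) (v : 'cV[R]_q) (i : 'I_q) :
  `|v i 0| <= linfnorm v.
Proof.
rewrite /linfnorm [leRHS]/Num.Def.normr/= mx_normrE.
by apply/bigmax_geP; right; exists (i, 0).
Qed.

Lemma linfnorm_attained (R : realType) (q : nat) (v : 'cV[R]_q) :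
  (0 < q)%N -> exists j, linfnorm v = `|v j 0|.
Proof.
move=> q_gt0; have [->|v_neq0] := eqVneq v 0.
  by exists (Ordinal q_gt0); rewrite /linfnorm normr0 mxE normr0.
have : mx_norm v != 0 by apply: contra v_neq0 => /eqP/mx_norm_eq0/eqP.
by move=> /mx_norm_neq0[[j l]/= vj]; exists j; rewrite -[0](ord1 l).
Qed.

Lemma dot_le_linfnorm (R : realType) (q : nat) (v : 'cV[R]_q) :
  dot v v <= q%:R * linfnorm v ^+ 2.
Proof.
have -> : q%:R * linfnorm v ^+ 2 = \sum_(i < q) linfnorm v ^+ 2.
  by rewrite sumr_const card_ord mulr_natl.
rewrite dotE; apply: ler_sum => i _.
rewrite -expr2 -real_normK ?num_real//.
by rewrite lerXn2r ?nnegrE ?normr_ge0 ?le_linfnorm.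
Qed.

(** * The smallest nonzero eigenvalue of a Gram matrix *)

(** A row [u] of the row space of [A^T] that [A] annihilates is orthogonal to
    itself, hence zero, so that [A^T *m A] has the same rank, and therefore the
    same row space, as [A]: normal equations are always solvable. *)
Lemma gram_solvable (R : realType) (m q : nat) (A : 'M[R]_(m, q))
    (z : 'cV[R]_m) :
  exists w : 'cV[R]_q, A^T *m (A *m w) = A^T *m z.
Proof.
have cap0 : (A^T :&: kermx A)%MS = 0.
  apply/eqP/rowV0P => u; rewrite sub_capmx.
  move=> /andP[/submxP[D uE] /sub_kermxP uA].
  have /dot_eq0 : dot u^T u^T = 0.
    by rewrite /dot trmxK [in u^T]uE trmx_mul trmxK mulmxA uA mul0mx mxE.
  by move=> /(congr1 trmx); rewrite trmxK trmx0.
have rankE : \rank (A^T *m A) = \rank A.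
  by rewrite -[RHS]mxrank_tr -(mxrank_mul_ker A^T A) cap0 mxrank0 addn0.
have subA : (A <= A^T *m A)%MS.
  by rewrite -(mxrank_leqif_sup (submxMl A^T A)).2 rankE.
have /submxP[D zE] : (z^T *m A <= A^T *m A)%MS by rewrite mulmx_sub.
exists D^T; apply: trmx_inj; rewrite !trmx_mul !trmxK zE.
by rewrite mulmxA.
Qed.

Lemma dot_mulmx_tr_continuous (R : realType) (m q : nat) (A : 'M[R]_(m, q)) :
  continuous (fun v : 'rV[R]_q => dot (A *m v^T) (A *m v^T)).
Proof.
under [X in continuous X]eq_fun do rewrite dotE.
apply: continuous_big => [|i _]; first exact: add_continuous.
suff cAi : continuous (fun v : 'rV[R]_q => (A *m v^T) i 0).
  by move=> v; exact: (continuousM (cAi v) (cAi v)).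
under [X in continuous X]eq_fun do rewrite mxE.
apply: continuous_big => [|j _]; first exact: add_continuous.
under [X in continuous X]eq_fun do rewrite mxE.
move=> v; apply: continuousM; first exact: cst_continuous.
exact: coord_continuous.
Qed.

(** The unit vectors of the row space of [A] form a compact set, which is cut
    out by the equations [dot v v = 1] and [v *m cokermx A = 0]. *)
Lemma rayleigh_min_attained (R : realType) (m q : nat) (A : 'M[R]_(m, q)) :
  A != 0 ->
  exists z0 : 'cV[R]_m, dot (A^T *m z0) (A^T *m z0) = 1 /\
    forall z : 'cV[R]_m,
      dot (A *m (A^T *m z0)) (A *m (A^T *m z0)) * dot (A^T *m z) (A^T *m z) <=
      dot (A *m (A^T *m z)) (A *m (A^T *m z)).
Proof.
move=> A_neq0.
pose f (B : 'M[R]_q) (v : 'rV[R]_q) := dot (B *m v^T) (B *m v^T).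
pose F (v : 'rV[R]_q) := dot (A *m v^T) (A *m v^T).
pose S : set 'rV[R]_q :=
  ([set v | f 1%:M v = 1] `&` [set v | f (cokermx A)^T v = 0])%classic.
have normalize z : dot (A^T *m z) (A^T *m z) != 0 ->
    S ((Num.sqrt (dot (A^T *m z) (A^T *m z)))^-1 *: (A^T *m z))^T.
  set v := A^T *m z => v_neq0; split; rewrite /= /f trmxK.
    rewrite mul1mx dotZZ exprVn sqr_sqrtr ?dot_ge0//.
    by rewrite mulVf.
  rewrite -scalemxAr /v mulmxA -trmx_mul mulmx_coker trmx0 mul0mx scaler0.
  exact: dotv0.
have range_of_S v : S v -> exists z, v^T = A^T *m z.
  move=> [_] /= /dot_eq0; rewrite -trmx_mul => /(congr1 trmx).
  rewrite trmxK trmx0 => /eqP; rewrite -submxE => /submxP[D ->].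
  by exists D^T; rewrite trmx_mul.
have unit_of_S v : S v -> dot v^T v^T = 1.
  by move=> [] /=; rewrite /f mul1mx.
have S_neq0 : (S !=set0)%classic.
  have [i Ai_neq0] : exists i, row i A != 0.
    apply/existsP; apply: contraNT A_neq0 => /existsPn A0.
    apply/eqP/row_matrixP => i; rewrite row0; apply/eqP.
    by rewrite -[_ == _]negbK.
  have rowE : A^T *m delta_mx i 0 = (row i A)^T by rewrite -colE tr_row.
  exists ((Num.sqrt (dot (A^T *m delta_mx i 0) (A^T *m delta_mx i 0)))^-1
            *: (A^T *m delta_mx i 0))^T.
  apply: normalize; rewrite rowE; apply: contra Ai_neq0 => /eqP/dot_eq0/eqP.
  by rewrite trmx_eq0.
have S_compact : compact S.
  apply: bounded_closed_compact.
    exists 1; split=> // M M_gt1 v Sv; apply/ltW/(le_lt_trans _ M_gt1).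
    rewrite [leLHS]/Num.Def.normr/= mx_normrE.
    apply: bigmax_le => // -[i j] _ /=.
    rewrite -(@ler_pXn2r _ 2) ?nnegrE// expr1n -(unit_of_S _ Sv) dotE.
    rewrite real_normK ?num_real// (bigD1 j)//= !mxE ord1 -expr2 lerDl.
    by rewrite sumr_ge0// => l _; rewrite -expr2 sqr_ge0.
  have f_closed B a : closed [set v | f B v = a]%classic.
    apply: (@preimage_closed _ _ (f B) [set x | x = a]%classic _
              (@closed_eq _ a)).
    by move=> v _; exact: dot_mulmx_tr_continuous.
  by apply: closedI; exact: f_closed.
have F_continuous : {within S, continuous F}%classic.
  by apply: continuous_subspaceT; exact: dot_mulmx_tr_continuous.
have [v0 /set_mem Sv0 v0_min] := compact_EVT_min S_neq0 S_compact F_continuous.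
have [z0 z0E] := range_of_S _ Sv0.
exists z0; rewrite -z0E; split; first exact: unit_of_S.
move=> z; have [nz|v_neq0] := eqVneq (dot (A^T *m z) (A^T *m z)) 0.
  by rewrite nz mulr0 dot_ge0.
have := v0_min _ (mem_set (normalize _ v_neq0)).
rewrite /F trmxK -scalemxAr dotZZ exprVn sqr_sqrtr ?dot_ge0//.
by rewrite mulrC ler_pdivlMr// lt_neqAle eq_sym v_neq0 dot_ge0.
Qed.

(** First-order condition at a minimum.  With [g] the gradient
    [A^T *m A *m v0 - mu *: v0] (up to a factor 2), which lies in the row space
    again, the quadratic form [dot (A v) (A v) - mu * dot v v] takes at
    [v0 + t *: g] the value [2 * t * dot g g + O(t ^+ 2)]; a small negative [t]
    would make it negative if [g] were nonzero. *)
Lemma rayleigh_min_eigenvector (R : realType) (m q : nat) (A : 'M[R]_(m, q))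
    (mu : R) (z0 : 'cV[R]_m) :
  (forall z : 'cV[R]_m, mu * dot (A^T *m z) (A^T *m z) <=
     dot (A *m (A^T *m z)) (A *m (A^T *m z))) ->
  mu * dot (A^T *m z0) (A^T *m z0) =
    dot (A *m (A^T *m z0)) (A *m (A^T *m z0)) ->
  A^T *m (A *m (A^T *m z0)) = mu *: (A^T *m z0).
Proof.
move=> mu_le mu_eq; apply/eqP; rewrite -subr_eq0; apply/eqP/dot_eq0.
set w := A *m (A^T *m z0) - mu *: z0.
have gE : A^T *m (A *m (A^T *m z0)) - mu *: (A^T *m z0) = A^T *m w.
  by rewrite /w mulmxBr -scalemxAr.
set v0 := A^T *m z0 in mu_eq gE *; set g := A^T *m w in gE.
rewrite gE; apply/eqP/negPn/negP => G_neq0.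
set G := dot g g in G_neq0.
have G_gt0 : 0 < G by rewrite lt_neqAle eq_sym G_neq0 dot_ge0.
have cross : dot (A *m v0) (A *m g) - mu * dot v0 g = G.
  rewrite dotC dot_mulmxl [dot v0 g]dotC -dotvZ -dotvB.
  by rewrite gE.
set B := dot (A *m g) (A *m g) - mu * G.
have B_ge0 : 0 <= B by rewrite subr_ge0; exact: mu_le.
have form_ge0 t : 0 <= 2 * t * G + t ^+ 2 * B.
  have := mu_le (z0 + t *: w).
  rewrite mulmxDr -scalemxAr -/v0 -/g mulmxDr -scalemxAr !dotDZ.
  rewrite -/G -mu_eq /B -[in 2 * t * G]cross => h; rewrite -subr_ge0 in h.
  by apply: le_trans h _; rewrite le_eqVlt; apply/orP; left; apply/eqP; ring.
pose s := (B + 1)^-1.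
have s_gt0 : 0 < s by rewrite invr_gt0; lra.
have sB : s * B < 2.
  have : s * (B + 1) = 1 by rewrite /s mulVf//; lra.
  lra.
(* the value at t = - s * G is s * G ^+ 2 * (s * B - 2) *)
have := form_ge0 (- (s * G)); apply/negP; rewrite -ltNge.
have -> : 2 * (- (s * G)) * G + (- (s * G)) ^+ 2 * B =
          s * G ^+ 2 * (s * B - 2) by ring.
by rewrite pmulr_rlt0 ?subr_lt0// mulr_gt0// exprn_gt0.
Qed.

(** The minimum of the Rayleigh quotient over the row space of [A] is the
    smallest nonzero eigenvalue of [A^T *m A]: it is an eigenvalue by the
    first-order condition, and an eigenvector for an eigenvalue [l != 0] equals
    [A^T *m (l^-1 *: A v)], so that its quotient [l] competes in the minimum. *)
Lemma lambda_pmin_rayleigh (R : realType) (m q : nat) (A : 'M[R]_(m, q)) :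
  A != 0 ->
  0 < lambda_pmin (A^T *m A) /\
  forall z : 'cV[R]_m, lambda_pmin (A^T *m A) * dot (A^T *m z) (A^T *m z) <=
    dot (A *m (A^T *m z)) (A *m (A^T *m z)).
Proof.
move=> /rayleigh_min_attained[z0 [unit0 min0]].
set mu := dot (A *m (A^T *m z0)) (A *m (A^T *m z0)) in min0.
have mu_eigen : A^T *m (A *m (A^T *m z0)) = mu *: (A^T *m z0).
  by apply: rayleigh_min_eigenvector => //; rewrite unit0 mulr1.
have mu_gt0 : 0 < mu.
  rewrite lt_neqAle dot_ge0 andbT eq_sym; apply/eqP => /dot_eq0 Av0.
  move: unit0; rewrite dot_mulmxl trmxK Av0 dotv0 => /eqP.
  by rewrite eq_sym oner_eq0.
suff -> : lambda_pmin (A^T *m A) = mu by [].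
apply: minimumE.
  split; last by rewrite gt_eqF.
  apply/eigenvalueP; exists (A^T *m z0)^T.
    apply: trmx_inj; rewrite trmx_mul trmxK trmx_mul trmxK -mulmxA mu_eigen.
    by rewrite linearZ /= trmxK.
  rewrite trmx_eq0; apply/eqP => v0; move: unit0; rewrite v0 dotv0 => /eqP.
  by rewrite eq_sym oner_eq0.
move=> l [/eigenvalueP[u uE u_neq0] l_neq0].
have AuE : A^T *m (A *m u^T) = l *: u^T.
  by apply: trmx_inj; rewrite !trmx_mul !trmxK -mulmxA uE linearZ /= trmxK.
have uz : u^T = A^T *m (l^-1 *: (A *m u^T)).
  by rewrite -scalemxAr AuE scalerA mulVf// scale1r.
have := min0 (l^-1 *: (A *m u^T)); rewrite -uz.
rewrite [X in _ <= X]dot_mulmxl AuE dotvZ ler_pM2r// lt_neqAle dot_ge0 andbT.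
rewrite eq_sym; apply: contra u_neq0 => /eqP/dot_eq0/eqP.
by rewrite trmx_eq0.
Qed.

(** Replacing [v] by its component [A^T *m z] in the row space changes neither
    side.  For that component [u], expand [dot (Q u - mu *: u) (Q u - mu *: u)],
    a nonnegative quantity, with [Q := A^T *m A], and bound [mu * dot u u] by
    [dot (A u) (A u)]. *)
Lemma lambda_pmin_le_gram (R : realType) (m q : nat) (A : 'M[R]_(m, q))
    (v : 'cV[R]_q) :
  A != 0 ->
  lambda_pmin (A^T *m A) * dot (A *m v) (A *m v) <=
    dot (A^T *m (A *m v)) (A^T *m (A *m v)).
Proof.
move=> /lambda_pmin_rayleigh[]; set mu := lambda_pmin _ => mu_gt0 mu_le.
have [z] := gram_solvable _ _ _ A^T v; rewrite trmxK => zE.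
rewrite -zE; set u := A^T *m z; have {mu_le} := mu_le z; rewrite -/u => mu_le.
have := dot_ge0 _ _ (A^T *m (A *m u) + (- mu) *: u).
rewrite dotDZ [dot (A^T *m _) u]dot_mulmxl trmxK.
have := ler_wpM2l (ltW mu_gt0) mu_le.
nra.
Qed.

(** * Least squares solutions *)

Section LeastSquaresSolutions.
Context {R : realType} {n p : nat}.
Variables (X : 'M[R]_(n, p)) (y : 'cV[R]_n) (b0 : 'cV[R]_p).
Hypothesis b0_normal : X^T *m (y - X *m b0) = 0.

(** Pythagoras: the residual [y - X *m b0] is orthogonal to the columns of
    [X]. *)
Lemma Ln_normal (b : 'cV[R]_p) :
  Ln X y b = Ln X y b0 + (2 * n%:R)^-1 * dot (X *m (b - b0)) (X *m (b - b0)).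
Proof.
rewrite /Ln !l2norm_sqr -mulrDr; congr (_ * _).
have -> : y - X *m b = (y - X *m b0) + (-1) *: (X *m (b - b0)).
  by rewrite mulmxBr scaleN1r opprB addrA subrK.
rewrite dotDZ [dot (y - _) (X *m _)]dotC dot_mulmxl b0_normal dotv0.
by ring.
Qed.

Lemma is_LS_normal : is_LS X y b0.
Proof.
by move=> b; rewrite (Ln_normal b) lerDl mulr_ge0 ?dot_ge0// invr_ge0 mulr_ge0.
Qed.

Lemma Lnstar_normal : Lnstar X y = Ln X y b0.
Proof.
apply: minimumE; first by exists b0.
by move=> _ [b _ <-]; exact: is_LS_normal.
Qed.

Lemma is_LS_fit (n_gt0 : (0 < n)%N) (b : 'cV[R]_p) :
  is_LS X y b -> X *m b = X *m b0.
Proof.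
move=> /(_ b0); rewrite (Ln_normal b) gerDl.
rewrite pmulr_rle0 ?invr_gt0 ?mulr_gt0 ?ltr0n// => le0.
apply/eqP; rewrite -subr_eq0 -mulmxBr; apply/eqP/dot_eq0/le_anti.
by rewrite le0 dot_ge0.
Qed.

Lemma fit_is_LS (b : 'cV[R]_p) : X *m b = X *m b0 -> is_LS X y b.
Proof.
move=> bE b'; have -> : Ln X y b = Ln X y b0 by rewrite /Ln bE.
exact: is_LS_normal.
Qed.

End LeastSquaresSolutions.

(** * Forward stagewise steps *)

Lemma correlationE (R : realType) (n p : nat) (X : 'M[R]_(n, p))
    (r : 'cV[R]_n) (j : 'I_p) :
  (X^T *m r) j 0 = dot r (col j X).
Proof. by rewrite dotC dotE mxE; apply: eq_bigr => i _; rewrite !mxE. Qed.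

Lemma dot_sub_sgn_le (R : realType) (n : nat) (eps : R) (d x : 'cV[R]_n) :
  l2norm x = 1 ->
  let d' := d - (eps * Num.sg (dot d x)) *: x in
  dot d' d' <= dot d d - 2 * eps * `|dot d x| + eps ^+ 2.
Proof.
move=> x_unit /=; rewrite -scaleNr dotDZ -[dot x x]l2norm_sqr x_unit.
rewrite normrEsg expr1n mulr1 sqrrN exprMn.
have -> : 2 * - (eps * Num.sg (dot d x)) * dot d x =
          - (2 * eps * (Num.sg (dot d x) * dot d x)) by ring.
rewrite lerD2l sqr_sg ler_piMr ?sqr_ge0//.
by case: eqP.
Qed.

Section Step.
Context {R : realType} {n p : nat}.
Variables (X : 'M[R]_(n, p)) (eps : R).
Variables (r r' : 'cV[R]_n) (b b' : 'cV[R]_p).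
Hypothesis step : FS_step X eps r b r' b'.

Lemma FS_step_residual (y : 'cV[R]_n) : r = y - X *m b -> r' = y - X *m b'.
Proof.
case: step => j [_ -> bj bl] rE.
suff -> : b' = b + (eps * Num.sg (dot r (col j X))) *: delta_mx j 0.
  by rewrite mulmxDr -scalemxAr -colE opprD addrA -rE.
apply/colP => l; rewrite !mxE eqxx andbT.
by have [->|/bl->] := eqVneq l j; rewrite ?mulr1 ?bj// mulr0 addr0.
Qed.

Lemma FS_step_l1norm : 0 < eps -> l1norm b' <= l1norm b + eps.
Proof.
move=> eps_gt0; case: step => j [_ _ bj bl].
rewrite /l1norm (bigD1 j)//= (bigD1 j (F := fun i => `|b i 0|))//= addrAC.
apply: lerD; last by apply: ler_sum => l /bl->.
rewrite bj (le_trans (ler_normD _ _))// lerD2l normrM gtr0_norm//.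
by rewrite ler_piMr ?(ltW eps_gt0)// normr_sg; case: eqP.
Qed.

Lemma FS_step_l0norm : (l0norm b' <= (l0norm b).+1)%N.
Proof.
case: step => j [_ _ _ bl].
have := (leq_card_setU [set j]%SET [set i | b i 0 != 0]%SET).1.
rewrite cards1 add1n; apply: leq_trans; apply: subset_leq_card.
apply/fintype.subsetP => l; rewrite !inE.
by have [//|/bl->] := eqVneq l j.
Qed.

(** Measured against a vector [s] orthogonal to the columns of [X], such as the
    least squares residual, the correlations of [r - s] and [r] coincide. *)
Lemma FS_step_descent (s : 'cV[R]_n) :
  (forall j : 'I_p, l2norm (col j X) = 1) -> 0 < eps -> (0 < p)%N ->
  X^T *m s = 0 ->
  dot (r' - s) (r' - s) <=
    dot (r - s) (r - s) - 2 * eps * linfnorm (X^T *m r) + eps ^+ 2.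
Proof.
move=> X_norm eps_gt0 p_gt0 s_orth; case: step => j [j_max -> _ _].
have corr l : dot (r - s) (col l X) = dot r (col l X).
  by rewrite -!correlationE mulmxBr s_orth subr0.
have -> : r - (eps * Num.sg (dot r (col j X))) *: col j X - s =
    (r - s) - (eps * Num.sg (dot (r - s) (col j X))) *: col j X.
  by rewrite corr addrAC.
apply: le_trans (dot_sub_sgn_le _ _ _ _ _ (X_norm j)) _.
rewrite corr lerD2r lerD2l lerN2 ler_pM2l ?mulr_gt0//.
by have [l ->] := linfnorm_attained _ _ (X^T *m r) p_gt0; rewrite correlationE.
Qed.

End Step.

Lemma exists_FS_step (R : realType) (n p : nat) (X : 'M[R]_(n, p)) (eps : R)
    (r : 'cV[R]_n) (b : 'cV[R]_p) :
  (0 < p)%N -> exists r' b', FS_step X eps r b r' b'.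
Proof.
move=> p_gt0; have [j jE] := linfnorm_attained _ _ (X^T *m r) p_gt0.
pose c := eps * Num.sg (dot r (col j X)).
exists (r - c *: col j X), (b + c *: delta_mx j 0), j; split=> //.
- by move=> l; rewrite -!correlationE -jE le_linfnorm.
- by rewrite !mxE !eqxx mulr1.
- by move=> l /negbTE lj; rewrite !mxE lj mulr0 addr0.
Qed.

(** If every [c t] exceeded the bound, each of the [k + 1] steps would lower
    [D] by more than [D 0 / (k + 1)], and [D] would end below zero. *)
Lemma exists_small_of_descent (R : realType) (eps : R) (k : nat)
    (D c : nat -> R) :
  0 < eps ->
  (forall t, (t <= k)%N -> D t.+1 <= D t - 2 * eps * c t + eps ^+ 2) ->
  0 <= D k.+1 ->
  exists2 i, (i <= k)%N & c i <= D 0%N / (2 * eps * (k + 1)%:R) + eps / 2.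
Proof.
move=> eps_gt0 desc Dlast; apply: contrapT => noi.
have : 0 < (k + 1)%:R :> R by rewrite ltr0n addn1.
have kE : k%:R = (k + 1)%:R - 1 :> R by rewrite natrD addrK.
move: (k + 1)%:R => N in kE noi * => N_gt0; set q := D 0%N / N.
have big t : (t <= k)%N -> q < 2 * eps * c t - eps ^+ 2.
  move=> tk; rewrite ltNge; apply/negP => small; apply: noi; exists t => //.
  have -> : D 0%N / (2 * eps * N) + eps / 2 = (q + eps ^+ 2) / (2 * eps).
    by rewrite /q; field; rewrite !gt_eqF.
  by rewrite ler_pdivlMr ?mulr_gt0//; lra.
have below t : (t <= k.+1)%N -> D t <= D 0%N - t%:R * q.
  elim: t => [_|t IHt tk]; first by rewrite mul0r subr0.
  have := IHt (ltnW tk); have := desc t tk; have := big t tk.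
  by rewrite -natr1; lra.
have qN : q * N = D 0%N by rewrite divfK// gt_eqF.
have := below k (leqnSn k); have := desc k (leqnn k); have := big k (leqnn k).
by rewrite kE; lra.
Qed.

Section Run.
Context {R : realType} {n p : nat}.
Variables (X : 'M[R]_(n, p)) (y : 'cV[R]_n) (eps : R) (k : nat).
Variables (r : nat -> 'cV[R]_n) (b : nat -> 'cV[R]_p).
Hypothesis run : FS_run X y eps k r b.

Lemma FS_run_residual (t : nat) : (t <= k)%N -> r t = y - X *m b t.
Proof.
case: run => r0 b0 steps; elim: t => [_|t IHt tk].
  by rewrite r0 b0 mulmx0 subr0.
exact: FS_step_residual _ _ _ _ _ _ (steps t tk) _ (IHt (ltnW tk)).
Qed.

Lemma FS_run_l1norm (t : nat) :
  0 < eps -> (t <= k)%N -> l1norm (b t) <= t%:R * eps.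
Proof.
move=> eps_gt0; case: run => _ b0 steps; elim: t => [_|t IHt tk].
  by rewrite b0 mul0r /l1norm big1// => i _; rewrite mxE normr0.
apply: le_trans (FS_step_l1norm _ _ _ _ _ _ (steps t tk) eps_gt0) _.
by rewrite -natr1 mulrDl mul1r lerD2r IHt// ltnW.
Qed.

Lemma FS_run_l0norm (t : nat) : (t <= k)%N -> (l0norm (b t) <= t)%N.
Proof.
case: run => _ b0 steps; elim: t => [_|t IHt tk].
  rewrite b0 /l0norm leqn0 cards_eq0; apply/eqP/setP => i.
  by rewrite !inE mxE eqxx.
apply: leq_trans (FS_step_l0norm _ _ _ _ _ _ (steps t tk)) _.
by rewrite ltnS IHt// ltnW.
Qed.

(** Telescoping needs [k + 1] decreases, one more than the run has steps: the
    last comes from an arbitrary further step out of [r k]. *)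
Lemma FS_run_small_correlation (s : 'cV[R]_n) :
  (forall j : 'I_p, l2norm (col j X) = 1) -> 0 < eps -> (0 < p)%N ->
  X^T *m s = 0 ->
  exists2 i, (i <= k)%N & linfnorm (X^T *m r i) <=
    dot (y - s) (y - s) / (2 * eps * (k + 1)%:R) + eps / 2.
Proof.
move=> X_norm eps_gt0 p_gt0 s_orth; case: run => r0 _ steps.
have [r' [b' last_step]] := exists_FS_step _ _ _ X eps (r k) (b k) p_gt0.
pose D t :=
  if (t <= k)%N then dot (r t - s) (r t - s) else dot (r' - s) (r' - s).
have D0 : D 0%N = dot (y - s) (y - s) by rewrite /D leq0n r0.
rewrite -D0; apply: exists_small_of_descent => //.
  move=> t tk; rewrite /D tk; case: ltngtP tk => // [tk _|-> _].
    by apply: FS_step_descent (steps t tk) _ _ _ _ _.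
  by apply: FS_step_descent last_step _ _ _ _ _.
by rewrite /D ltnn dot_ge0.
Qed.

End Run.

(** * Convergence bounds *)

(** Up to sign, the normal equations identify the correlations of the residual
    at [b] with the image of [b - b0] under the Gram matrix. *)
Lemma fit_error_le_correlation (R : realType) (n p : nat) (X : 'M[R]_(n, p))
    (y : 'cV[R]_n) (b0 b : 'cV[R]_p) :
  X != 0 -> X^T *m (y - X *m b0) = 0 ->
  lambda_pmin (X^T *m X) * dot (X *m (b - b0)) (X *m (b - b0)) <=
    p%:R * linfnorm (X^T *m (y - X *m b)) ^+ 2.
Proof.
move=> X_neq0 b0_normal.
apply: le_trans (lambda_pmin_le_gram _ _ _ _ _ X_neq0) _.
have -> : X^T *m (X *m (b - b0)) = (-1) *: (X^T *m (y - X *m b)).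
  apply/eqP; rewrite scaleN1r -subr_eq0 opprK -mulmxDr mulmxBr.
  by rewrite addrC addrA subrK b0_normal.
by rewrite dotZZ sqrrN expr1n mul1r dot_le_linfnorm.
Qed.

(** Among the vectors with the same fit as [b0], the one closest to [b] differs
    from [b] by an element of the row space of [X], where the Rayleigh bound
    applies. *)
Lemma exists_close_same_fit (R : realType) (n p : nat) (X : 'M[R]_(n, p))
    (b0 b : 'cV[R]_p) :
  X != 0 ->
  exists2 b1 : 'cV[R]_p, X *m b1 = X *m b0 &
    lambda_pmin (X^T *m X) * dot (b - b1) (b - b1) <=
      dot (X *m (b - b0)) (X *m (b - b0)).
Proof.
move=> X_neq0.
have [z] := gram_solvable _ _ _ X^T (b - b0); rewrite trmxK => zE.
exists (b - X^T *m z).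
  by rewrite mulmxBr zE mulmxBr opprB addrC subrK.
by rewrite subKr -zE; exact: (lambda_pmin_rayleigh _ _ _ _ X_neq0).2.
Qed.

Lemma l2norm_le (R : realType) (m : nat) (v : 'cV[R]_m) (a : R) :
  0 <= a -> dot v v <= a ^+ 2 -> l2norm v <= a.
Proof.
by move=> a_ge0; rewrite -l2norm_sqr ler_pXn2r// nnegrE l2norm_ge0.
Qed.

Theorem theorem3p1 (R : realType) (n p : nat)
    (X : 'M[R]_(n, p)) (y : 'cV[R]_n)
    (X_mean : forall j : 'I_p, mean (col j X) = 0)
    (X_norm : forall j : 'I_p, l2norm (col j X) = 1)
    (y_mean : mean y = 0)
    (p_gt0 : (0 < p)%N)
    (eps : R) (eps_gt0 : 0 < eps) (k : nat)
    (r : nat -> 'cV[R]_n) (b : nat -> 'cV[R]_p)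
    (run : FS_run X y eps k r b) :
  exists i : nat, (i <= k)%N /\
    (* (i) *)
    (forall bLS : 'cV[R]_p, is_LS X y bLS ->
       Ln X y (b i) - Lnstar X y <=
         p%:R / (2 * n%:R * lambda_pmin (X^T *m X)) *
         (l2norm (X *m bLS) ^+ 2 / (eps * (k + 1)%:R) + eps) ^+ 2) /\
    (* (ii) *)
    (exists biLS : 'cV[R]_p, is_LS X y biLS /\
       forall bLS : 'cV[R]_p, is_LS X y bLS ->
         l2norm (b i - biLS) <=
           Num.sqrt p%:R / lambda_pmin (X^T *m X) *
           (l2norm (X *m bLS) ^+ 2 / (eps * (k + 1)%:R) + eps)) /\
    (* (iii) *)
    (forall bLS : 'cV[R]_p, is_LS X y bLS ->
       l2norm (X *m b i - X *m bLS) <=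
         Num.sqrt p%:R / Num.sqrt (lambda_pmin (X^T *m X)) *
         (l2norm (X *m bLS) ^+ 2 / (eps * (k + 1)%:R) + eps)) /\
    (* (iv) *)
    (forall bLS : 'cV[R]_p, is_LS X y bLS ->
       linfnorm (X^T *m r i) <=
         l2norm (X *m bLS) ^+ 2 / (2 * eps * (k + 1)%:R) + eps / 2) /\
    (* (v) *)
    l1norm (b i) <= k%:R * eps /\
    (* (vi) *)
    (l0norm (b i) <= k)%N.
Proof.
have col_neq0 : col (Ordinal p_gt0) X != 0.
  apply/eqP => col0; move: (l2norm_sqr _ _ (col (Ordinal p_gt0) X)).
  by rewrite X_norm col0 dot0v expr1n => /eqP; rewrite oner_eq0.
have X_neq0 : X != 0 by apply: contraNneq col_neq0 => ->; rewrite col0.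
have n_gt0 : (0 < n)%N.
  rewrite lt0n; apply: contraNneq X_neq0 => n0; apply/eqP/matrixP => l.
  by have := ltn_ord l; rewrite {2}n0.
have [b0 b0E] := gram_solvable _ _ _ X y.
have b0_normal : X^T *m (y - X *m b0) = 0 by rewrite mulmxBr b0E subrr.
have [i ik] :=
  FS_run_small_correlation _ _ _ _ _ _ run _ X_norm eps_gt0 p_gt0 b0_normal.
rewrite subKr => small.
have [mu_gt0 _] := lambda_pmin_rayleigh _ _ _ X X_neq0.
have fit := fit_error_le_correlation _ _ _ _ _ _ (b i) X_neq0 b0_normal.
rewrite -(FS_run_residual _ _ _ _ _ _ run _ ik) in fit.
have [b1 b1_fit b1_close] := exists_close_same_fit _ _ _ X b0 (b i) X_neq0.
have LS_fit bLS : is_LS X y bLS -> X *m bLS = X *m b0.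
  exact: is_LS_fit b0_normal n_gt0 _.
have mu0 : lambda_pmin (X^T *m X) != 0 by rewrite gt_eqF.
set mu := lambda_pmin _ in mu_gt0 mu0 fit b1_close *.
set E := dot (X *m (b i - b0)) _ in fit b1_close.
pose B := dot (X *m b0) (X *m b0) / (eps * (k + 1)%:R) + eps.
have B_ge0 : 0 <= B.
  by rewrite addr_ge0 ?(ltW eps_gt0)// divr_ge0 ?dot_ge0// mulr_ge0// ltW.
have BE bLS : is_LS X y bLS ->
    l2norm (X *m bLS) ^+ 2 / (eps * (k + 1)%:R) + eps = B.
  by move=> /LS_fit bLSE; rewrite l2norm_sqr bLSE.
have M_le : linfnorm (X^T *m r i) <= B.
  apply: le_trans small _.
  have -> : dot (X *m b0) (X *m b0) / (2 * eps * (k + 1)%:R) + eps / 2 = B / 2.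
    rewrite /B; have : (k + 1)%:R != 0 :> R by rewrite pnatr_eq0 addn1.
    by move: (k + 1)%:R => N N_neq0; field; rewrite N_neq0 gt_eqF.
  by rewrite ler_pdivrMr// mulr2n mulrDr mulr1 lerDl.
have E_le : E <= p%:R * B ^+ 2 / mu.
  rewrite ler_pdivlMr// mulrC; apply: le_trans fit _.
  by rewrite ler_wpM2l// lerXn2r ?nnegrE ?normr_ge0.
exists i; split=> //; split.
  move=> bLS /BE ->.
  rewrite (Lnstar_normal _ _ _ b0_normal) (Ln_normal _ _ _ b0_normal (b i)).
  rewrite addrC addKr -/E.
  have -> : p%:R / (2 * n%:R * mu) * B ^+ 2 =
            (2 * n%:R)^-1 * (p%:R * B ^+ 2 / mu).
    by field; rewrite mu0 pnatr_eq0 -lt0n.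
  by rewrite ler_wpM2l// invr_ge0 mulr_ge0.
split.
  exists b1; split; first exact: fit_is_LS b0_normal _ b1_fit.
  move=> bLS /BE ->; apply: l2norm_le.
    by rewrite mulr_ge0// divr_ge0 ?sqrtr_ge0// ltW.
  rewrite exprMn expr_div_n sqr_sqrtr//.
  have -> : p%:R / mu ^+ 2 * B ^+ 2 = p%:R * B ^+ 2 / mu / mu by field.
  rewrite ler_pdivlMr// mulrC; exact: le_trans E_le.
split.
  move=> bLS bLS_LS; rewrite (BE _ bLS_LS) (LS_fit _ bLS_LS) -mulmxBr.
  apply: l2norm_le.
    by rewrite mulr_ge0// divr_ge0 ?sqrtr_ge0.
  rewrite exprMn expr_div_n !sqr_sqrtr//; last exact: ltW.
  by rewrite mulrAC.
split; first by move=> bLS /LS_fit bLSE; rewrite l2norm_sqr bLSE.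
split; last exact: leq_trans (FS_run_l0norm _ _ _ _ _ _ run _ ik) ik.
apply: le_trans (FS_run_l1norm _ _ _ _ _ _ run _ eps_gt0 ik) _.
by rewrite ler_wpM2r ?ler_nat// ltW.
Qed.
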